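(* For every $n\ge 3$, $$N'(T_n)=N(T_n)=n-1,\qquad N'(PT_n)=N(PT_n)=n,\qquad N'(I_n)=N(I_n)=n .$$
   Context: $PT_n$ is the semigroup, under composition (functions act on the right), of all partial functions from $X_n=\{1,\dots,n\}$ to itself; $T_n$ is its subsemigroup of functions with domain $X_n$, and $I_n$ its subsemigroup of injective partial functions. A generating set of a finite semigroup $S$ is a non-empty subset $A\subseteq S$ such that every element of $S$ is a product of one or more elements of $A$ (inverses are not allowed); it is minimal if no proper subset is a generating set; $\mathrm{rank}(S)$ is the smallest cardinality of a generating set. For a generating set $A$ and $s\in S$, the length $l_A(s)$ is the least $k$ such that $s=a_1\cdots a_k$ with $a_i\in A$, except that the identity element of $S$ (if there is one) has length $0$ by convention. $\ker(S)$ is the minimum ideal of $S$ and $N(S,A)=\min\{l_A(s): s\in\ker(S)\}$. $N(S)$ is the minimum of $N(S,A)$ over all generating sets $A$ with $|A|=\mathrm{rank}(S)$; $N'(S)$ is the minimum of $N(S,A)$ over all minimal generating sets $A$. *)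

(* Defs.v *)
From HB Require Import structures.
From mathcomp Require Import all_boot.
From mathcomp Require Import boolp.

Set Implicit Arguments.
Unset Strict Implicit.
Unset Printing Implicit Defensive.

Local Open Scope group_scope.

(* Least natural number satisfying P, with junk value 0 if there is none. *)
Definition minnat (P : nat -> Prop) : nat :=
  if pselect (exists k, `[< P k >]) is left exP then ex_minn exP else 0%N.

Lemma minnatP (P : nat -> Prop) : (exists k, P k) ->
  P (minnat P) /\ (forall k, P k -> minnat P <= k)%N.
Proof.
case=> k Pk; rewrite /minnat; case: pselect => [exP|[]]; last first.
  by exists k; apply/asboolP.
case: ex_minnP => m /asboolP Pm min_m; split=> // j Pj.
by apply: min_m; apply/asboolP.
Qed.

#[short(type="finMonoidType")]
HB.structure Definition FinMonoid := {M of Monoid M & Finite M}.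

(* A finite semigroup is a nonempty subset S, closed under multiplication, of *)
(* an ambient finite monoid M. The unit of M plays no role below: products    *)
(* are over nonempty words, and the identity of S, if any, is intrinsic to S. *)
Section FiniteSemigroups.
Variable M : finMonoidType.
Implicit Types (S A B I K : {set M}) (s e a : M) (w : seq M) (k : nat).

Definition word_of_length A k s w :=
  [/\ size w = k, all (fun a => a \in A) w & s = \big[*%g/1]_(a <- w) a].

Definition product_of_length A k s :=
  (0 < k)%N /\ exists w, word_of_length A k s w.

Definition generating S A :=
  [/\ A != set0, A \subset S & {in S, forall s, exists k, product_of_length A k s}].

Definition minimal_generating S A :=
  generating S A /\ (forall B, B \proper A -> ~ generating S B).

Definition rank S := minnat (fun k => exists2 A, generating S A & #|A| = k).

Definition is_identity S e :=
  (e \in S) && [forall s in S, (e * s == s) && (s * e == s)].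

Definition word_length S A s : nat :=
  if is_identity S s then 0%N else minnat (fun k => product_of_length A k s).

Definition ideal S I :=
  [&& I != set0, I \subset S &
      [forall s in S, forall x in I, (s * x \in I) && (x * s \in I)]].

Definition minimum_ideal S K :=
  ideal S K && [forall I : {set M}, ideal S I ==> (K \subset I)].

(* Junk value set0 if S has no minimum ideal; see ker_minimum. *)
Definition ker S : {set M} := odflt set0 [pick K | minimum_ideal S K].

Definition Nwrt S A : nat :=
  minnat (fun k => exists2 s, s \in ker S & word_length S A s = k).

Definition N S : nat :=
  minnat (fun k => exists A,
    [/\ generating S A, #|A| = rank S & Nwrt S A = k]).

Definition N' S : nat :=
  minnat (fun k => exists2 A, minimal_generating S A & Nwrt S A = k).

Lemma idealI S I K : ideal S I -> ideal S K -> ideal S (I :&: K).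
Proof.
case/and3P=> /set0Pn[x Ix] sIS /forall_inP idI.
case/and3P=> /set0Pn[y Ky] sKS /forall_inP idK.
have xS := subsetP sIS _ Ix; have yS := subsetP sKS _ Ky.
apply/and3P; split.
- apply/set0Pn; exists (x * y); rewrite inE.
  have /forall_inP/(_ _ Ix)/andP[_ ->] := idI _ yS.
  by have /forall_inP/(_ _ Ky)/andP[-> _] := idK _ xS.
- exact: subset_trans (subsetIl _ _) sIS.
apply/forall_inP=> s Ss; apply/forall_inP=> z /setIP[Iz Kz]; rewrite !inE.
have /forall_inP/(_ _ Iz)/andP[-> ->] := idI _ Ss.
by have /forall_inP/(_ _ Kz)/andP[-> ->] := idK _ Ss.
Qed.

Lemma ker_minimum S : S != set0 -> {in S &, forall x y, x * y \in S} ->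
  minimum_ideal S (ker S).
Proof.
move=> S0 mulS; rewrite /ker; case: pickP => //= noK.
have idS : ideal S S.
  rewrite /ideal S0 subxx; apply/forall_inP=> s Ss; apply/forall_inP=> x Sx.
  by rewrite !mulS.
case: (arg_minnP (fun I : {set M} => #|I|) idS) => K idK minK.
have [/negP[]] := noK K; apply/andP; split=> //; apply/forall_inP=> I idI.
apply/setIidPl/eqP; rewrite eqEcard subsetIl minK //; exact: idealI.
Qed.

End FiniteSemigroups.

(* Partial transformations of X_n; None encodes "undefined". *)
Definition ptrans n := {ffun 'I_n -> option 'I_n}.

Section PartialTransformations.
Variable n : nat.
Implicit Types f g h : ptrans n.

HB.instance Definition _ := Finite.on (ptrans n).

(* Functions act on the right: f * g means f first, then g. *)
Definition ptrans_mul f g : ptrans n := [ffun x => obind g (f x)].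
Definition ptrans_one : ptrans n := [ffun x => Some x].

Fact ptrans_mulA : associative ptrans_mul.
Proof.
move=> f g h; apply/ffunP=> x; rewrite !ffunE.
by case: (f x) => //= y; rewrite ffunE.
Qed.

Fact ptrans_mul1 : left_id ptrans_one ptrans_mul.
Proof. by move=> f; apply/ffunP=> x; rewrite !ffunE. Qed.

Fact ptrans_mulr1 : right_id ptrans_one ptrans_mul.
Proof.
move=> f; apply/ffunP=> x; rewrite !ffunE.
by case: (f x) => //= y; rewrite ffunE.
Qed.

HB.instance Definition _ :=
  isMonoid.Build (ptrans n) ptrans_mulA ptrans_mul1 ptrans_mulr1.

Lemma ptransM f g x : (f * g) x = obind g (f x).
Proof. exact: ffunE. Qed.

Definition PT : {set ptrans n} := [set: ptrans n].

Definition T : {set ptrans n} := [set f : ptrans n | [forall x, f x != None]].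

Definition I : {set ptrans n} :=
  [set f : ptrans n |
    [forall x, forall y, (f x != None) && (f x == f y) ==> (x == y)]].

Lemma T_mul : {in T &, forall f g, f * g \in T}.
Proof.
move=> f g; rewrite !inE => /forallP Tf /forallP Tg; apply/forallP=> x.
by rewrite ptransM; case: (f x) (Tf x) => //= y _; apply: Tg.
Qed.

Lemma I_mul : {in I &, forall f g, f * g \in I}.
Proof.
move=> f g; rewrite !inE => /forallP If /forallP Ig.
apply/forallP=> x; apply/forallP=> y; rewrite !ptransM.
have /forallP/(_ y) := If x; case: (f x) (f y) => [u|] [v|] //=; last first.
  by move=> _; rewrite andNb.
have /forallP/(_ v) := Ig u => /implyP guv /implyP fxy.
by apply/implyP=> /guv/eqP uv; apply: fxy; rewrite uv.
Qed.

End PartialTransformations.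

(* Main.v *)
Require Import Defs.
From mathcomp Require Import all_boot fingroup perm zify.

Set Implicit Arguments.
Unset Strict Implicit.
Unset Printing Implicit Defensive.

Local Open Scope group_scope.

(** Measure a partial map by its rank, the size of its image; the rank n maps
    are the permutations.  A product of rank r in which every factor has rank
    at least n - 1 has at least n - r factors, because multiplying by such a
    factor lowers the rank by at most one ([trank_mul_ge], [trank_word]).

    Each of T_n, PT_n and I_n is generated by its elements of rank at least
    n - 1: a map of rank below n is a map of larger rank followed by a
    redirection, which fixes all points but one ([peel], [peelable_ind]).  A
    product never has larger rank than its factors, so in any generating set
    the elements of rank at least n - 1 already generate; hence a minimal
    generating set has no others ([minimal_trank]).  As the kernel consists of
    maps of rank at most r, with r = 1 for T_n and r = 0 for PT_n and I_n, its
    elements have length at least n - r over a minimal generating set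
    ([Nwrt_ge]).

    The bound is reached by an exchange that turns a generating set of least
    cardinality into another one.  In any generating set A, the permutations
    in A generate the symmetric group, and the other members of A
    can be exchanged for descents ([exchange]): maps sending x to x - 1 for
    x > 0, and 0 to 0 or to nothing.  Up to a rotation a descent is a
    redirection, and conjugation by permutations provides the other ones, so
    generation survives.  The exchange does not enlarge A: T_n and I_n need a
    single descent while A must contain a non-permutation; PT_n needs both
    descents while A must contain a map that is not total and a map that is
    total but not a permutation.  The power n - r of a descent is constant and
    lies in the kernel. *)

(** * Least values, generation and the kernel *)

Lemma minnat_mem (P : nat -> Prop) k : P k -> P (minnat P).
Proof. by move=> Pk; have [] := minnatP (ex_intro P k Pk). Qed.

Lemma minnat_le (P : nat -> Prop) k : P k -> (minnat P <= k)%N.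
Proof. by move=> Pk; have [_] := minnatP (ex_intro P k Pk); apply. Qed.

Lemma minnat_eq (P : nat -> Prop) b :
  P b -> (forall k, P k -> b <= k)%N -> minnat P = b.
Proof.
move=> Pb minb; apply/eqP.
by rewrite eqn_leq minnat_le // minb //; apply: minnat_mem Pb.
Qed.

Section Generation.
Variable M : finMonoidType.
Implicit Types (S A B : {set M}) (s e a : M).

Definition mul_closed (P : M -> Prop) := forall a b, P a -> P b -> P (a * b).

Definition generated A s := exists k, product_of_length A k s.

Lemma generated_mem A a : a \in A -> generated A a.
Proof.
move=> Aa; exists 1%N; split=> //; exists [:: a].
by split; rewrite //= ?Aa // big_seq1.
Qed.

Lemma generated_mul A : mul_closed (generated A).
Proof.
move=> a b [k [k0 [v [sv Av ->]]]] [l [l0 [w [sw Aw ->]]]].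
exists (k + l)%N; split; first by rewrite addn_gt0 k0.
by exists (v ++ w); split; rewrite ?size_cat ?sv ?sw ?all_cat ?Av ?big_cat.
Qed.

Lemma product_pow A a k : a \in A -> 0 < k -> product_of_length A k (a ^+ k).
Proof.
move=> Aa k0; split=> //; exists (nseq k a); split.
- exact: size_nseq.
- by rewrite all_nseq Aa orbT.
by elim: k {k0} => [|k IHk]; rewrite ?big_nil //= big_cons -IHk expgS.
Qed.

Lemma generated_ind A (P : M -> Prop) : mul_closed P ->
  {in A, forall a, P a} -> forall s, generated A s -> P s.
Proof.
move=> mulP AP s [k [k0 [w [sw + ->]]]]; rewrite -{k}sw in k0 *.
elim: w k0 => // a [|b w] IHw _ /= /andP[Aa Aw].
  by rewrite big_seq1; apply: AP.
by rewrite big_cons; apply: mulP; [apply: AP | apply: IHw].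
Qed.

Lemma generating_generated S A s : generating S A -> s \in S -> generated A s.
Proof. by case=> _ _; apply. Qed.

Lemma generatingI S A e : A \subset S -> e \in S ->
  {in S, forall s, generated A s} -> generating S A.
Proof.
move=> sAS Se genA; split=> //; apply/set0Pn.
have [k [k0 [[|a w] [sw + _]]]] := genA e Se; first by rewrite -sw in k0.
by case/andP=> Aa _; exists a.
Qed.

(** Otherwise the closed property C would spread from A to all of S. *)
Lemma generating_notsub S A (C : pred M) e : mul_closed C ->
  generating S A -> e \in S -> ~~ C e -> exists2 a, a \in A & ~~ C a.
Proof.
move=> mulC genA Se; case: (pickP [pred a in A | ~~ C a]) => [a|AC].
  by case/andP; exists a.
move/negP; case; apply: (generated_ind (P := C)) (generating_generated genA Se).
  exact: mulC.
by move=> a Aa; have /negbT := AC a; rewrite /= Aa negbK.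
Qed.

Lemma rank_le S A : generating S A -> (rank S <= #|A|)%N.
Proof. by move=> genA; apply: minnat_le; exists A. Qed.

Lemma rank_ex S : S != set0 -> exists2 A, generating S A & #|A| = rank S.
Proof.
case/set0Pn=> s Ss.
have genS : generating S S.
  by apply: (generatingI (e := s)) => // a; apply: generated_mem.
apply: (@minnat_mem (fun k => exists2 A, generating S A & #|A| = k) #|S|).
by exists S.
Qed.

Lemma rank_minimal S A :
  generating S A -> #|A| = rank S -> minimal_generating S A.
Proof.
move=> genA rA; split=> // B /proper_card ltBA genB.
by move/rank_le: genB; rewrite -rA leqNgt ltBA.
Qed.

(** The two invariants agree because a generating set of least cardinality is
    minimal: a lower bound over minimal generating sets applies to both, and
    it is enough to reach it without increasing the cardinality. *)
Lemma N_of_bounds S b : S != set0 ->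
  (forall A, minimal_generating S A -> b <= Nwrt S A)%N ->
  (forall A, generating S A ->
    exists B, [/\ generating S B, #|B| <= #|A| & Nwrt S B <= b]%N) ->
  N' S = N S /\ N S = b.
Proof.
move=> S0 lowb upb; have [A genA rA] := rank_ex S0.
have [B [genB leBA NBb]] := upb A genA.
have rB : #|B| = rank S by apply/eqP; rewrite eqn_leq -{1}rA leBA rank_le.
have minB := rank_minimal genB rB.
have NB : Nwrt S B = b by apply/eqP; rewrite eqn_leq NBb lowb.
have -> : N S = b.
  apply: minnat_eq; first by exists B.
  by move=> k [C [genC rC <-]]; apply/lowb/rank_minimal.
split=> //; apply: minnat_eq; first by exists B.
by move=> k [C minC <-]; apply: lowb.
Qed.

(** An ideal contains s * z for each of its members s. *)
Lemma mem_ker S z : S != set0 -> {in S &, forall x y, x * y \in S} ->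
  z \in S -> {in S, forall s, s * z = z} -> z \in ker S.
Proof.
move=> S0 mulS Sz zr.
have /andP[/and3P[/set0Pn[x Kx] sKS idK] _] := ker_minimum S0 mulS.
have := forall_inP (forall_inP idK z Sz) x Kx.
by rewrite (zr x (subsetP sKS x Kx)) => /andP[].
Qed.

Lemma ker_sub S J : S != set0 -> {in S &, forall x y, x * y \in S} ->
  ideal S J -> ker S \subset J.
Proof.
move=> S0 mulS idJ; have /andP[_ /forallP/(_ J)] := ker_minimum S0 mulS.
by rewrite idJ.
Qed.

End Generation.

(** * Rank of partial transformations *)

Section Transformations.
Variable n : nat.
Implicit Types (f g : ptrans n) (S A : {set ptrans n}).

Definition im f : {set 'I_n} := [set y | [exists x, f x == Some y]].
Definition dom f : {set 'I_n} := [set x | f x != None].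
Definition trank f := #|im f|.

Lemma imP f y : reflect (exists x, f x = Some y) (y \in im f).
Proof. by rewrite inE; apply: (iffP existsP) => -[x fx]; exists x; exact/eqP. Qed.

(** Gives access to the cardinality lemmas on direct images. *)
Lemma trank_imset f : trank f = #|f @: dom f|.
Proof.
rewrite /trank -(card_imset (im f) (@Some_inj _)).
have -> // : Some @: im f = f @: dom f.
apply/setP=> o; apply/imsetP/imsetP => [[y /imP[x fx] ->]|[x]].
  by exists x; rewrite ?inE fx.
rewrite inE; case fx: (f x) => [y|] // _ ->.
by exists y => //; apply/imP; exists x.
Qed.

Lemma TP f : reflect (forall x, f x <> None) (f \in T n).
Proof. by rewrite inE; apply: (iffP forallP) => Tf x; apply/eqP. Qed.

Lemma IP f :
  reflect (forall x y, f x <> None -> f x = f y -> x = y) (f \in I n).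
Proof.
rewrite inE; apply: (iffP forallP) => [If x y /eqP fx /eqP fxy | If x].
  by apply/eqP; have /forallP/(_ y)/implyP := If x; apply; rewrite fx.
apply/forallP=> y; apply/implyP=> /andP[/eqP fx /eqP fxy].
exact/eqP/If.
Qed.

Lemma trank_max f : (trank f <= n)%N.
Proof. by rewrite -[leqRHS]card_ord max_card. Qed.

(** The rank is at most the number of points where f is defined, with equality
    only if f is injective there; so the rank n maps are the permutations. *)
Lemma trank_full f : (trank f == n) = (f \in T n :&: I n).
Proof.
apply/eqP/setIP => [fn | [/TP Tf /IP If]]; last first.
  have domf : dom f = setT by apply/setP=> x; rewrite !inE; apply/eqP/Tf.
  rewrite trank_imset domf card_imset ?cardsT ?card_ord // => x y.
  by apply: If; apply: Tf.
have domn : #|dom f| = n.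
  apply/eqP; rewrite eqn_leq -[X in (_ <= X)%N && _]card_ord max_card /=.
  by have := leq_imset_card f (dom f); rewrite -trank_imset fn.
have domT : dom f = setT.
  by apply/eqP; rewrite eqEcard subsetT cardsT card_ord domn leqnn.
have injf : {in dom f &, injective f}.
  by apply/imset_injP; rewrite domn -trank_imset fn.
split; last by apply/IP=> x y _; apply: injf; rewrite domT inE.
by apply/TP=> x; apply/eqP; have := in_setT x; rewrite -domT inE.
Qed.

Lemma im_full f : trank f = n -> im f = setT.
Proof.
rewrite /trank => rf; apply/eqP.
by rewrite eqEcard subsetT cardsT card_ord rf /=.
Qed.

Lemma im_mul f g : im (f * g) \subset im g.
Proof.
apply/subsetP=> y /imP[x]; rewrite ptransM.
by case: (f x) => //= u gu; apply/imP; exists u.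
Qed.

Lemma trank_mulr f g : trank (f * g) <= trank g.
Proof. exact/subset_leq_card/im_mul. Qed.

Lemma trank_mull f g : trank (f * g) <= trank f.
Proof.
rewrite /trank -(card_imset (im (f * g)) (@Some_inj _)).
apply: leq_trans (leq_imset_card g (im f)); apply/subset_leq_card/subsetP=> o.
case/imsetP=> y /imP[x]; rewrite ptransM.
case fx: (f x) => [u|] //= gu ->; rewrite -gu; apply: imset_f.
by apply/imP; exists x.
Qed.

(** The image of g is the image of im f, which is im (f * g), together with the
    image of the n - trank f points outside im f. *)
Lemma trank_mul_ge f g : trank f + trank g <= trank (f * g) + n.
Proof.
have sub : Some @: im g \subset Some @: im (f * g) :|: g @: ~: im f.
  apply/subsetP=> _ /imsetP[y /imP[u gu] ->]; rewrite inE.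
  have [/imP[x fx] | nfu] := boolP (u \in im f); last first.
    by rewrite -gu imset_f ?orbT // inE.
  by rewrite imset_f //; apply/imP; exists x; rewrite ptransM fx.
have := leq_trans (subset_leq_card sub) (leq_card_setU _ _).
rewrite !(card_imset _ (@Some_inj _)) => le_g.
have le_img := leq_trans le_g (leq_add (leqnn _) (leq_imset_card g (~: im f))).
have cardC : (trank f + #|~: im f|)%N = n by rewrite /trank cardsC card_ord.
have : trank f + trank g <= trank (f * g) + (trank f + #|~: im f|).
  by rewrite addnCA leq_add2l.
by rewrite cardC.
Qed.

Lemma trank1 : trank 1 = n.
Proof.
apply/eqP; rewrite trank_full inE; apply/andP; split.
  by apply/TP=> x; rewrite ffunE.
by apply/IP=> x y _; rewrite !ffunE => -[].
Qed.

Lemma trank_word A (w : seq (ptrans n)) :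
  {in A, forall a, n <= (trank a).+1}%N -> all (fun a => a \in A) w ->
  n <= trank (\big[*%g/1]_(a <- w) a) + size w.
Proof.
move=> Abig; elim: w => [|a w IHw] /=; first by rewrite big_nil trank1 addn0.
case/andP=> Aa /IHw le_w; rewrite big_cons.
set p := bigop _ _ _ in le_w *.
by have := trank_mul_ge a p; have := Abig a Aa; lia.
Qed.

(** The factors of a product have at least its rank, so elements of smaller
    rank cannot occur in a word for f. *)
Lemma generated_trank A m f : generated A f -> m <= trank f ->
  generated [set a in A | m <= trank a] f.
Proof.
move=> genA; move: f genA.
apply: generated_ind => [f g Pf Pg le_m | a Aa le_m].
  apply: generated_mul; first exact/Pf/(leq_trans le_m)/trank_mull.
  exact/Pg/(leq_trans le_m)/trank_mulr.
by apply: generated_mem; rewrite inE Aa.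
Qed.

(** * Factorization into redirections *)

Definition redirect c o : ptrans n := [ffun x => if x == c then o else Some x].

Lemma trank_redirect c o : n <= (trank (redirect c o)).+1.
Proof.
have sub : [set~ c] \subset im (redirect c o).
  apply/subsetP=> x; rewrite !inE => xc; apply/existsP; exists x.
  by rewrite ffunE (negbTE xc).
have := subset_leq_card sub; rewrite cardsC1 card_ord => le_n.
exact: leq_trans (leqSpred n) _.
Qed.

Lemma redirect_T c o : (redirect c o \in T n) = (o != None).
Proof.
apply/TP/idP => [/(_ c)|/eqP o0 x]; rewrite ffunE ?eqxx; first by move/eqP.
by case: ifP.
Qed.

Lemma redirect_I c : redirect c None \in I n.
Proof.
by apply/IP=> x y; rewrite !ffunE; case: eqP => // _; case: eqP => // _ _ [].
Qed.

Lemma redirect_notI c d : d <> c -> redirect c (Some d) \notin I n.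
Proof.
move=> dc; apply/negP=> /IP/(_ c d); rewrite !ffunE eqxx.
by move/eqP/negbTE: (dc) => -> dcE; apply: dc; rewrite -dcE.
Qed.

(** Let c be missed by f, and let a be a point where f is undefined or whose
    value is also taken elsewhere.  Sending a to c instead adds c to the image
    and loses no other value; redirecting c to f a afterwards restores f.  If f
    is total then so are both factors; if f is injective then f a is undefined
    and both factors are injective. *)
Lemma peel f : trank f < n -> exists g c o,
  [/\ trank g = (trank f).+1, o <> Some c, f = g * redirect c o,
      f \in T n -> g \in T n /\ redirect c o \in T n
    & f \in I n -> g \in I n /\ redirect c o \in I n].
Proof.
move=> ltfn.
have [c imfc] : exists c, c \notin im f.
  apply/existsP; rewrite -negb_forall; apply: contraTN ltfn => /forallP imf.
  rewrite -leqNgt -[leqLHS]card_ord -cardsT.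
  apply/subset_leq_card/subsetP=> x _.
  exact: imf.
have ncf x : f x <> Some c by move=> fx; case/imP: imfc; exists x.
have [a fa] : exists a, f a = None \/ exists2 b, b != a & f b = f a.
  have: f \notin T n :&: I n by rewrite -trank_full ltn_eqF.
  rewrite inE negb_and => /orP[]; rewrite inE => /forallPn[a].
    by rewrite negbK => /eqP fa; exists a; left.
  case/forallPn=> b; rewrite negb_imply -andbA => /and3P[_ /eqP fab ab].
  by exists a; right; exists b; rewrite // eq_sym.
pose g : ptrans n := [ffun x => if x == a then Some c else f x].
have fE : f = g * redirect c (f a).
  apply/ffunP=> x; rewrite ptransM ffunE.
  case: eqP => [->|_] /=; first by rewrite ffunE eqxx.
  case fx: (f x) => [y|] //=; rewrite ffunE; case: eqP => // yc.
  by case: (ncf x); rewrite fx yc.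
exists g, c, (f a); split=> //.
- have -> : trank g = #|c |: im f|.
    suff: im g = c |: im f by rewrite /trank => ->.
    apply/setP=> y; rewrite in_setU1; apply/imP/orP => [[x]|].
      rewrite ffunE; case: eqP => [_ [->]|_ fx]; first by left.
      by right; apply/imP; exists x.
    case=> [/eqP->|/imP[x fx]]; first by exists a; rewrite ffunE eqxx.
    have [xa|xa] := eqVneq x a; last by exists x; rewrite ffunE (negbTE xa).
    case: fa => [|[b ba fba]]; first by rewrite -xa fx.
    by exists b; rewrite ffunE (negbTE ba) fba -xa.
  by rewrite cardsU1 imfc.
- move=> Tf; rewrite redirect_T; split; last exact/eqP/(TP _ Tf).
  by apply/TP=> x; rewrite ffunE; case: ifP => // _; apply: (TP _ Tf).
move=> /IP If; have fa0 : f a = None.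
  case fa_: (f a) fa => [y|] // -[] // [b ba fba].
  by case/eqP: ba; apply: If; rewrite // fba.
rewrite fa0 redirect_I; split=> //; apply/IP=> x y; rewrite !ffunE.
case: eqP => [->|_]; case: eqP => [->|_] //; last exact: If.
  by move=> _ cy; case: (ncf y).
by move=> _ /ncf.
Qed.

(** The form of [peel] that stays inside S, shared by the three semigroups. *)
Definition peelable S := forall f, f \in S -> trank f < n -> exists g c o,
  [/\ g \in S, trank g = (trank f).+1, o <> Some c, redirect c o \in S
    & f = g * redirect c o].

Lemma peelable_PT : peelable (PT n).
Proof.
move=> f _ /peel[g [c [o [rg oc fE _ _]]]].
by exists g, c, o; split; rewrite ?inE.
Qed.

Lemma peelable_T : peelable (T n).
Proof.
move=> f Tf /peel[g [c [o [rg oc fE /(_ Tf)[Tg Tr] _]]]].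
by exists g, c, o.
Qed.

Lemma peelable_I : peelable (I n).
Proof.
move=> f If /peel[g [c [o [rg oc fE _ /(_ If)[Ig Ir]]]]].
by exists g, c, o.
Qed.

Lemma peelable_ind S (Q : ptrans n -> Prop) : peelable S -> mul_closed Q ->
  (forall f, trank f = n -> Q f) ->
  (forall c o, o <> Some c -> redirect c o \in S -> Q (redirect c o)) ->
  forall f, f \in S -> Q f.
Proof.
move=> peelS mulQ Qunit Qred f.
have [k le_k] := ubnP (n - trank f); elim: k f le_k => // k IHk f le_k Sf.
have := trank_max f; rewrite leq_eqVlt => /orP[/eqP/Qunit //|ltf].
have [g [c [o [Sg rg oc Sr ->]]]] := peelS f Sf ltf.
apply: mulQ; last exact: Qred.
apply: IHk => //; rewrite rg; lia.
Qed.

(** * Depth of the kernel *)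

(** Common to the three semigroups: E is the set of non-permutations that an
    exchange puts into a generating set, e is the member of E that reaches the
    kernel in n - r steps, [redirectE] keeps the exchanged set generating, and
    [leE] keeps it from growing. *)
Section Depth.
Variables (S E : {set ptrans n}) (r : nat) (e : ptrans n).
Hypothesis mulS : {in S &, forall f g, f * g \in S}.
Hypothesis unitS : forall f, trank f = n -> f \in S.
Hypothesis peelS : peelable S.
Hypothesis ltrn : r < n.
Hypothesis sES : E \subset S.
Hypothesis Ee : e \in E.
Hypothesis trank_z : trank (e ^+ (n - r)) <= r.
Hypothesis right_zero : {in S, forall s, s * e ^+ (n - r) = e ^+ (n - r)}.
Hypothesis redirectE : forall Q : ptrans n -> Prop, mul_closed Q ->
  (forall f, trank f = n -> Q f) -> {in E, forall f, Q f} ->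
  forall c o, o <> Some c -> redirect c o \in S -> Q (redirect c o).
Hypothesis leE : forall A, generating S A ->
  #|E| <= #|[set a in A | trank a < n]|.

Let z := e ^+ (n - r).

Let S1 : 1 \in S. Proof. exact/unitS/trank1. Qed.

Let S0 : S != set0. Proof. by apply/set0Pn; exists 1. Qed.

Let Sz : z \in S.
Proof.
have genz : generated E z.
  by exists (n - r)%N; apply: product_pow; rewrite ?subn_gt0.
move: genz; apply: (generated_ind (P := fun s => s \in S)).
  by move=> a b; apply: mulS.
by move=> a; apply: (subsetP sES).
Qed.

Let kerz : z \in ker S. Proof. exact: mem_ker. Qed.

Lemma trank_ker s : s \in ker S -> trank s <= r.
Proof.
have idJ : ideal S [set f in S | trank f <= r].
  apply/and3P; split.
  - by apply/set0Pn; exists z; rewrite inE Sz.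
  - by apply/subsetP=> f; rewrite inE => /andP[].
  apply/forall_inP=> f Sf; apply/forall_inP=> g; rewrite !inE => /andP[Sg le_r].
  rewrite !mulS //= (leq_trans (trank_mulr _ _)) //.
  exact: leq_trans (trank_mull _ _) _.
by move/(subsetP (ker_sub S0 mulS idJ)); rewrite inE => /andP[].
Qed.

Lemma word_length_ker A s : s \in ker S ->
  word_length S A s = minnat (fun k => product_of_length A k s).
Proof.
move=> /trank_ker le_r; rewrite /word_length; case: ifP => // /andP[Ss].
move/forall_inP/(_ 1 S1)/andP=> [/eqP s1 _].
by move: le_r; rewrite -[s]mulg1 s1 trank1 leqNgt ltrn.
Qed.

(** The members of A of rank at least n - 1 generate all permutations and all
    redirections, hence S; by minimality there are no other members. *)
Lemma minimal_trank A a :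
  minimal_generating S A -> a \in A -> n <= (trank a).+1.
Proof.
case=> genA minA Aa; pose A' := [set a in A | n.-1 <= trank a].
suff genA' : generating S A'.
  have : A' \subset A by apply/subsetP=> b; rewrite inE => /andP[].
  rewrite subEproper => /orP[/eqP A'A | /minA //].
  by move: Aa; rewrite -A'A inE => /andP[_]; lia.
have big f : f \in S -> n.-1 <= trank f -> generated A' f.
  by move=> Sf; apply: generated_trank; apply: generating_generated genA Sf.
apply: (generatingI _ S1).
  case: genA => _ sAS _; apply/subsetP=> b.
  by rewrite inE => /andP[/(subsetP sAS)].
apply: (peelable_ind peelS); first exact: generated_mul.
  by move=> f rf; apply: big; [apply: unitS | rewrite rf leq_pred].
by move=> c o _ Sr; apply: big => //; have := trank_redirect c o; lia.
Qed.

Lemma Nwrt_ge A : minimal_generating S A -> n - r <= Nwrt S A.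
Proof.
move=> minA; rewrite /Nwrt.
have [s ks <-] := @minnat_mem
  (fun k => exists2 s, s \in ker S & word_length S A s = k)
  _ (ex_intro2 _ _ z kerz erefl).
rewrite (word_length_ker A ks).
have Ss : s \in S.
  by have /andP[/and3P[_ /subsetP-> //]] := ker_minimum S0 mulS.
have [k pk] := generating_generated minA.1 Ss.
have [_ [w [<- Aw sE]]] := @minnat_mem (fun k => product_of_length A k s) k pk.
have := trank_word (fun a => minimal_trank minA (a := a)) Aw.
rewrite -sE leq_subLR => le_n; apply: leq_trans le_n _.
by rewrite leq_add2r trank_ker.
Qed.

(** The members of rank n of A still generate the permutations, since a product
    of rank n has all factors of rank n; E supplies the redirections. *)
Lemma exchange A : generating S A ->
  exists B, [/\ generating S B, #|B| <= #|A| & Nwrt S B <= n - r].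
Proof.
move=> genA; pose U := [set a in A | n <= trank a].
have sUA : U \subset A by apply/subsetP=> a; rewrite inE => /andP[].
exists (U :|: E); split.
- apply: (generatingI _ S1).
    by rewrite subUset sES (subset_trans sUA) //; case: genA.
  have genU f : trank f = n -> generated (U :|: E) f.
    move=> rf; have Sf := unitS rf.
    have := generated_trank (generating_generated genA Sf).
    move/(_ n); rewrite rf leqnn => /(_ isT).
    apply: generated_ind; first exact: generated_mul.
    by move=> a Ua; apply: generated_mem; rewrite inE Ua.
  apply: (peelable_ind peelS) => //; first exact: generated_mul.
  apply: redirectE => //; first exact: generated_mul.
  by move=> a Ea; apply: generated_mem; rewrite inE Ea orbT.
- apply: leq_trans (leq_card_setU _ _) _.
  rewrite -(cardsID U A) (setIidPr sUA) leq_add2l (leq_trans (leE genA)) //.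
  apply/subset_leq_card/subsetP=> a; rewrite !inE => /andP[-> lta].
  by rewrite -ltnNge lta.
have le_z : word_length S (U :|: E) z <= n - r.
  rewrite word_length_ker //; apply: minnat_le; apply: product_pow.
    by rewrite inE Ee orbT.
  by rewrite subn_gt0.
by apply: leq_trans le_z; apply: minnat_le; exists z.
Qed.

Theorem N_depth : N' S = N S /\ N S = (n - r)%N.
Proof. by apply: N_of_bounds S0 Nwrt_ge exchange. Qed.

End Depth.

End Transformations.

(** * Descents *)

Definition of_perm n (s : {perm 'I_n}) : ptrans n := [ffun x => Some (s x)].

Lemma trank_of_perm n (s : {perm 'I_n}) : trank (of_perm s) = n.
Proof.
apply/eqP; rewrite trank_full inE; apply/andP; split.
  by apply/TP=> x; rewrite ffunE.
by apply/IP=> x y _; rewrite !ffunE => -[/perm_inj].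
Qed.

Lemma redirect_conj n (s : {perm 'I_n}) c o :
  of_perm s * redirect (s c) (omap s o) * of_perm s^-1 = redirect c o.
Proof.
apply/ffunP=> x; rewrite !ptransM !ffunE /= ffunE (inj_eq perm_inj).
by case: eqP => _ /=; [case: o => //= y | ]; rewrite ffunE permK.
Qed.

Definition const n (o : option 'I_n) : ptrans n := [ffun=> o].

Section Descent.
Variable m : nat.
Let n := m.+2.
Let zero : 'I_n := ord0.
Let one : 'I_n := inord 1.

(** For o = Some 0 this is the total map collapsing 0 and 1; for o = None it is
    the nilpotent partial injection of rank n - 1. *)
Definition descent (o : option 'I_n) : ptrans n :=
  [ffun x : 'I_n => if x == zero then o else Some (inord x.-1)].

(** The hypothesis says that o absorbs: once a point has fallen to o, it stays
    there. *)
Lemma descent_exp o k : obind (descent o) o = o ->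
  descent o ^+ k =
    [ffun x : 'I_n => if k <= x then Some (inord (x - k)) else o].
Proof.
move=> fixo; elim: k => [|k IHk].
  by apply/ffunP=> x; rewrite !ffunE subn0 inord_val.
apply/ffunP=> x; rewrite expgSr ptransM IHk !ffunE.
have [lekx|ltxk] := leqP k x; last by rewrite fixo ltnNge ltnW.
have ltn : (x - k < n)%N by apply: leq_ltn_trans (leq_subr _ _) (ltn_ord x).
rewrite /= ffunE -val_eqE /= inordK // subn_eq0.
by case: leqP => // _; rewrite subnS.
Qed.

(** Rotating by one undoes the shift and leaves the change at 0 only. *)
Lemma descent_rot o : descent o * of_perm (perm (can_inj (@ordSK n))) =
  redirect zero (omap (@ordS n) o).
Proof.
apply/ffunP=> x; rewrite ptransM !ffunE; case: eqP => [_|x0] /=.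
  by case: o => //= y; rewrite ffunE permE.
have x1 : (0 < x)%N by rewrite lt0n; apply/eqP=> x0'; apply/x0/val_inj.
have ltx : x.-1 < n by apply: leq_ltn_trans (leq_pred x) (ltn_ord x).
rewrite ffunE permE; congr Some; apply/val_inj => /=.
by rewrite inordK // prednK // modn_small.
Qed.

Section Closed.
Variable Q : ptrans n -> Prop.
Hypothesis mulQ : mul_closed Q.
Hypothesis unitQ : forall f, trank f = n -> Q f.

Let Qperm s : Q (of_perm s). Proof. exact/unitQ/trank_of_perm. Qed.

Lemma closed_redirect_None : Q (descent None) -> forall c, Q (redirect c None).
Proof.
move=> Qd c; rewrite -(redirect_conj (tperm c zero)) tpermL /=.
apply/mulQ/Qperm/mulQ; first exact: Qperm.
by rewrite -[None]/(omap (@ordS n) None) -descent_rot; apply: mulQ.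
Qed.

Lemma closed_redirect_Some : Q (descent (Some zero)) ->
  forall c d, d <> c -> Q (redirect c (Some d)).
Proof.
move=> Qd c d dc.
(* u sends c to 0 and d to 1: the first transposition moves d to d', which is
   not 0, and the second leaves 0 alone. *)
pose d' := tperm c zero d; pose u := (tperm c zero * tperm d' one)%g.
have d'0 : d' != zero by rewrite -(tpermL c zero) (inj_eq perm_inj); apply/eqP.
have uc : u c = zero.
  rewrite permM tpermL tpermD //; apply/eqP=> /(congr1 val) /=.
  by rewrite inordK.
have ud : u d = one by rewrite permM tpermL.
rewrite -(redirect_conj u) uc /= ud.
apply/mulQ/Qperm/mulQ; first exact: Qperm.
have -> : Some one = omap (@ordS n) (Some zero).
  by congr Some; apply/val_inj; rewrite /= inordK.
by rewrite -descent_rot; apply: mulQ.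
Qed.

End Closed.

Lemma descent_pow_None : descent None ^+ (n - 0) = const None.
Proof.
rewrite descent_exp // subn0; apply/ffunP=> x; rewrite !ffunE.
by rewrite leqNgt ltn_ord.
Qed.

Lemma descent_pow_Some : descent (Some zero) ^+ (n - 1) = const (Some zero).
Proof.
rewrite descent_exp /= ?ffunE //; apply/ffunP=> x; rewrite !ffunE.
have := ltn_ord x; rewrite subn1 /= ltnS => le_x; case: leqP => // ge_x.
have -> : (x - m.+1 = 0)%N by apply/eqP; rewrite subn_eq0.
by congr Some; apply/val_inj; rewrite /= inordK.
Qed.

End Descent.

(** * The three semigroups *)

Section Nonunits.
Variable n : nat.

Lemma trank_const_None : trank (const (None : option 'I_n)) = 0.
Proof.
apply/eqP; rewrite /trank cards_eq0; apply/eqP/setP=> y.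
by rewrite in_set0; apply/imP=> -[x]; rewrite ffunE.
Qed.

Lemma trank_const_Some (y : 'I_n) : trank (const (Some y)) <= 1.
Proof.
rewrite /trank -(cards1 y); apply/subset_leq_card/subsetP=> u /imP[x].
by rewrite ffunE inE => -[->].
Qed.

Lemma unit_mul_closed : mul_closed (fun f : ptrans n => trank f == n).
Proof.
move=> f g /eqP rf /eqP rg; rewrite eqn_leq trank_max /=.
by have := trank_mul_ge f g; rewrite rf rg leq_add2r.
Qed.

Lemma generating_nonunit (S A : {set ptrans n}) z : z \in S -> trank z < n ->
  generating S A -> 0 < #|[set a in A | trank a < n]|.
Proof.
move=> Sz ltz genA.
have [|a Aa nua] := generating_notsub unit_mul_closed genA Sz.
  by rewrite neq_ltn ltz.
by apply/card_gt0P; exists a; rewrite inE Aa ltn_neqAle nua trank_max.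
Qed.

End Nonunits.

Section Depths.
Variable m : nat.
Let n := m.+2.
Let zero : 'I_n := ord0.

Lemma unit_T (f : ptrans n) : trank f = n -> f \in T n.
Proof. by move/eqP; rewrite trank_full => /setIP[]. Qed.

Lemma unit_I (f : ptrans n) : trank f = n -> f \in I n.
Proof. by move/eqP; rewrite trank_full => /setIP[]. Qed.

Lemma const_Some_T : const (Some zero) \in T n.
Proof. by apply/TP=> x; rewrite ffunE. Qed.

Lemma mul_const_Some :
  {in T n, forall f, f * const (Some zero) = const (Some zero)}.
Proof.
move=> f /TP Tf; apply/ffunP=> x; rewrite ptransM !ffunE.
by case: (f x) (Tf x) => //= y _; rewrite ffunE.
Qed.

Lemma mul_const_None (f : ptrans n) : f * const None = const None.
Proof.
apply/ffunP=> x; rewrite ptransM !ffunE.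
by case: (f x) => //= y; rewrite ffunE.
Qed.

Lemma descent_Some_T : descent (Some zero) \in T n.
Proof. by apply/TP=> x; rewrite ffunE; case: ifP. Qed.

Lemma descent_None_I : descent (None : option 'I_n) \in I n.
Proof.
apply/IP=> x y; rewrite !ffunE; case: eqP => // x0; case: eqP => // y0 _.
move=> [] /(congr1 val) /=; have := ltn_ord x; have := ltn_ord y => ltx lty.
rewrite !inordK; try exact: leq_ltn_trans (leq_pred _) _.
have pos (u : 'I_n) : u <> ord0 -> 0 < u.
  by move=> u0; rewrite lt0n; apply/eqP=> e0; apply/u0/val_inj.
by move=> exy; apply/val_inj; rewrite -[LHS]prednK ?pos // exy prednK ?pos.
Qed.

Lemma depth_T : N' (T n) = N (T n) /\ N (T n) = (n - 1)%N.
Proof.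
have cE := @descent_pow_Some m.
apply: (N_depth
  (E := [set descent (Some zero)]) (e := descent (Some zero))) => //.
- exact: T_mul.
- exact: unit_T.
- exact: peelable_T.
- by rewrite sub1set descent_Some_T.
- by rewrite inE.
- by rewrite cE trank_const_Some.
- by rewrite cE; exact: mul_const_Some.
- move=> Q mulQ unitQ QE c [d|] dc; last by rewrite redirect_T.
  move=> _; apply: closed_redirect_Some => //; first by apply: QE; rewrite inE.
  by move=> dc'; apply: dc; rewrite dc'.
move=> A genA; rewrite cards1.
apply: generating_nonunit const_Some_T _ genA.
exact: leq_ltn_trans (trank_const_Some _) _.
Qed.

Lemma depth_I : N' (I n) = N (I n) /\ N (I n) = n.
Proof.
have cE := @descent_pow_None m.
rewrite -[X in _ /\ _ = X](subn0 n).
apply: (N_depth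
  (E := [set descent None]) (e := descent None)) => //.
- exact: I_mul.
- exact: unit_I.
- exact: peelable_I.
- by rewrite sub1set descent_None_I.
- by rewrite inE.
- by rewrite cE trank_const_None.
- by rewrite cE => f _; exact: mul_const_None.
- move=> Q mulQ unitQ QE c [d|] dc; last first.
    by move=> _; apply: closed_redirect_None => //; apply: QE; rewrite inE.
  by rewrite (negbTE (redirect_notI _)) // => dc'; apply: dc; rewrite dc'.
move=> A genA; rewrite cards1.
apply: (generating_nonunit (z := const None)) genA; last first.
  by rewrite trank_const_None.
by apply/IP=> x y; rewrite ffunE.
Qed.

(** A permutation followed by a map undefined at y is undefined at the preimage
    of y.  So a generating set of PT_n contains a total non-permutation. *)
Lemma nontotal_mul_closed :
  mul_closed (fun f : ptrans n => (trank f == n) || (f \notin T n)).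
Proof.
have notT (f : ptrans n) : f \notin T n -> exists x, f x = None.
  by rewrite inE => /forallPn[x]; rewrite negbK => /eqP; exists x.
move=> f g /orP[rf|/notT[x fx]] Pg; last first.
  by apply/orP; right; apply/TP=> /(_ x); rewrite ptransM fx.
have [rg|nrg] := boolP (trank g == n); first by rewrite unit_mul_closed.
rewrite (negbTE nrg) /= in Pg; have [y gy] := notT _ Pg.
have /imP[x fx] : y \in im f.
  by rewrite (im_full (eqP rf)) inE.
by apply/orP; right; apply/TP=> /(_ x); rewrite ptransM fx.
Qed.

Lemma depth_PT : N' (PT n) = N (PT n) /\ N (PT n) = n.
Proof.
have cE := @descent_pow_None m.
rewrite -[X in _ /\ _ = X](subn0 n).
apply: (N_depth
  (E := [set descent None; descent (Some zero)]) (e := descent None)) => //.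
- by move=> f g _ _; apply: in_setT.
- exact: peelable_PT.
- exact: subsetT.
- by rewrite !inE eqxx.
- by rewrite cE trank_const_None.
- by rewrite cE => f _; exact: mul_const_None.
- move=> Q mulQ unitQ QE c [d|] dc _; last first.
    by apply: closed_redirect_None => //; apply: QE; rewrite !inE eqxx.
  apply: closed_redirect_Some => //.
    by apply: QE; rewrite !inE eqxx orbT.
  by move=> dc'; apply: dc; rewrite dc'.
move=> A genA; apply: (@leq_trans 2); first by rewrite cards2; case: eqP.
have T_mul_closed : mul_closed (fun f : ptrans n => f \in T n).
  by move=> f g; apply: T_mul.
have [||a Aa nTa] := generating_notsub (e := const None) T_mul_closed genA.
- by rewrite inE.
- by apply/TP=> /(_ zero); rewrite ffunE.
have [||b Ab] :=
  generating_notsub (e := const (Some zero)) nontotal_mul_closed genA.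
- by rewrite inE.
- rewrite const_Some_T orbF neq_ltn (leq_ltn_trans (trank_const_Some _)) //.
rewrite negb_or negbK => /andP[rb Tb].
have ab : a != b by apply: contraNneq nTa => ->.
have sab : [set a; b] \subset [set a in A | trank a < n].
  apply/subsetP=> f; rewrite !inE ltn_neqAle trank_max andbT.
  case/orP=> /eqP->; rewrite ?Aa ?Ab //=.
  by apply: contraNN nTa => /eqP/unit_T.
by apply: leq_trans (subset_leq_card sab); rewrite cards2 ab.
Qed.

End Depths.

Theorem corollary3p17 (n : nat) (hn : (3 <= n)%N) :
  [/\ N' (T n) = N (T n) /\ N (T n) = (n - 1)%N,
      N' (PT n) = N (PT n) /\ N (PT n) = n
    & N' (I n) = N (I n) /\ N (I n) = n].
Proof.
case: n hn => [|[|m]] // _.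
by split; [apply: depth_T | apply: depth_PT | apply: depth_I].
Qed.
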